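(* Let $G = \mathrm{SL}_4(\mathbb{Z})$. For a positive integer $r$, let $p_1, \dots, p_r$ be the first $r$ odd primes, let $H_r = \prod_{i=1}^r \mathrm{SL}_4(\mathbb{F}_{p_i})$, let $Z_r = \prod_{i=1}^r \{\pm I_4\} \lhd H_r$ (where the $i$-th factor is the subgroup $\{\pm I_4\}$ of $\mathrm{SL}_4(\mathbb{F}_{p_i})$), let $\pi_r \colon G \to H_r$ be the homomorphism given by reduction modulo $p_1, \dots, p_r$, and set $L_r = \pi_r^{-1}(Z_r)$, a finite index normal subgroup of $G$, and $n_r = [G : L_r]$. Then for all sufficiently large $r$, $$\mathrm{rank}(L_r) \geq \frac{\log(n_r)}{48\log\log(n_r)}.$$
   Context: The rank $\mathrm{rank}(L)$ of a group $L$ is the smallest cardinality of a generating set of $L$. $\log$ denotes the natural logarithm. $I_4$ is the $4 \times 4$ identity matrix, and $\mathbb{F}_p$ is the field with $p$ elements. *)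

(* Defs.v *)
From HB Require Import structures.
From mathcomp Require Import all_boot all_order all_algebra all_fingroup.
From mathcomp Require Import finmap.
From mathcomp Require Import all_classical all_reals all_analysis.

Set Implicit Arguments.
Unset Strict Implicit.
Unset Printing Implicit Defensive.

Import Order.TTheory GRing.Theory Num.Theory.

Local Open Scope classical_set_scope.
Local Open Scope ring_scope.

Record SL (n : nat) (R : comUnitRingType) :=
  MkSL { SLval :> 'M[R]_n ; _ : \det SLval == 1 }.

HB.instance Definition _ n (R : comUnitRingType) := [isSub for @SLval n R].
HB.instance Definition _ n (R : comUnitRingType) := [Choice of SL n R by <:].

Section SLGroup.
Variables (n : nat) (R : comUnitRingType).
Implicit Types A B : SL n R.

Lemma SL_det A : \det A = 1.
Proof. by case: A => A /= /eqP. Qed.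

Lemma SL_unitmx A : (A : 'M[R]_n) \in unitmx.
Proof. by rewrite unitmxE SL_det unitr1. Qed.

Fact SL_one_subproof : \det (1%:M : 'M[R]_n) == 1.
Proof. by rewrite det1. Qed.

Fact SL_mul_subproof A B : \det (A *m B) == 1.
Proof. by rewrite det_mulmx !SL_det mulr1. Qed.

Fact SL_inv_subproof A : \det (invmx A) == 1.
Proof. by rewrite det_inv SL_det invr1. Qed.

Definition SL_one : SL n R := MkSL SL_one_subproof.
Definition SL_mul A B : SL n R := MkSL (SL_mul_subproof A B).
Definition SL_inv A : SL n R := MkSL (SL_inv_subproof A).

Fact SL_mulA : associative SL_mul.
Proof. by move=> A B C; apply: val_inj; rewrite /= mulmxA. Qed.

Fact SL_mul1 : left_id SL_one SL_mul.
Proof. by move=> A; apply: val_inj; rewrite /= mul1mx. Qed.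

Fact SL_mulr1 : right_id SL_one SL_mul.
Proof. by move=> A; apply: val_inj; rewrite /= mulmx1. Qed.

Fact SL_mulV : left_inverse SL_one SL_inv SL_mul.
Proof. by move=> A; apply: val_inj; rewrite /= mulVmx // SL_unitmx. Qed.

Fact SL_mulrV : right_inverse SL_one SL_inv SL_mul.
Proof. by move=> A; apply: val_inj; rewrite /= mulmxV // SL_unitmx. Qed.

HB.instance Definition _ :=
  isGroup.Build (SL n R) SL_mulA SL_mul1 SL_mulr1 SL_mulV SL_mulrV.

End SLGroup.

HB.instance Definition _ n (R : finComUnitRingType) := [Finite of SL n R by <:].

Section SLMap.
Variables (n : nat) (R S : comUnitRingType) (f : {rmorphism R -> S}).

Fact SL_map_subproof (A : SL n R) : \det (map_mx f A) == 1.
Proof. by rewrite det_map_mx SL_det rmorph1. Qed.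

Definition SL_map (A : SL n R) : SL n S := MkSL (SL_map_subproof A).

Lemma SL_mapM : {morph SL_map : A B / (A * B)%g}.
Proof. by move=> A B; apply: val_inj; rewrite /= map_mxM. Qed.

Lemma SL_map1 : SL_map 1%g = 1%g.
Proof. by apply: val_inj; rewrite /= map_mx1. Qed.

End SLMap.

Section Groups.
Variable G : groupType.
Implicit Types H L S : set G.

Definition is_subgroup H : Prop := group_closed (mem H).

Definition is_normal_subgroup H : Prop :=
  is_subgroup H /\ forall g h : G, H h -> H (h ^ g)%g.

Definition generated S : set G := smallest is_subgroup S.

Definition left_cosets H : set (set G) :=
  [set [set (g * h)%g | h in H] | g in [set: G]].

(* [G : H]; the value is 0 when there are infinitely many cosets, which does not
   happen for the subgroups [L_ r] by [L_finite_index]. *)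
Definition group_index H : nat := #|` fset_set (left_cosets H)|.

(* The smallest cardinality of a generating set of the subgroup [L], all the
   infinite cardinalities being identified with [+oo]; the infimum is a minimum
   by [group_rank_attained]. *)
Definition group_rank (R : realType) L : \bar R :=
  ereal_inf [set counting S | S in [set S | generated S = L]].

Lemma is_subgroupP H :
  is_subgroup H <-> H 1%g /\ forall x y, H x -> H y -> H (x * y^-1)%g.
Proof.
split=> -[H1 HB]; split.
- by rewrite -in_setE.
- by move=> x y /mem_set Hx /mem_set Hy; rewrite -in_setE; apply: HB.
- by apply/mem_set.
- move=> x y /set_mem Hx /set_mem Hy; apply/mem_set; exact: HB.
Qed.

Lemma generated_subgroup L : is_subgroup L -> generated L = L.
Proof.
move=> sL; apply/seteqP; split; first by apply: smallest_sub.
exact: sub_gen_smallest.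
Qed.

Lemma group_rank_attained (R : realType) L : is_subgroup L ->
  exists2 S, generated S = L & counting S = group_rank R L.
Proof.
move=> sL; pose P n := exists2 S, generated S = L & counting S = n%:R%:E :> \bar R.
have [[n0 Pn0]|noP] := pselect (exists n, P n); last first.
  exists L; first exact: generated_subgroup.
  have inftyS S : generated S = L -> counting S = +oo%E :> \bar R.
    move=> gS; rewrite /counting; case: ifPn => // /asboolP fS.
    case: noP; exists #|` fset_set S|; exists S => //.
    by rewrite /counting asboolT.
  rewrite inftyS; last exact: generated_subgroup.
  apply/esym/eqP; rewrite -leye_eq; apply: le_ereal_inf_tmp => _ [S /= gS <-].
  by rewrite inftyS.
have exP : exists n, `[< P n >] by exists n0; apply/asboolP.
case: (ex_minnP exP) => m /asboolP[S gS cS] mmin; exists S => //.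
apply/eqP; rewrite eq_le; apply/andP; split; last first.
  by apply: ereal_inf_lbound; exists S.
apply: le_ereal_inf_tmp => _ [T /= gT <-]; rewrite cS.
have [fT|iT] := pselect (finite_set T); last first.
  by rewrite /counting asboolF// leey.
rewrite /counting asboolT// lee_fin ler_nat; apply: mmin.
by apply/asboolP; exists T => //; rewrite /counting asboolT.
Qed.

End Groups.

Fact next_prime_subproof n : exists q, (n < q)%N && prime q.
Proof. by case: (prime_above n) => q nq pq; exists q; rewrite nq pq. Qed.

Definition next_prime n : nat := ex_minn (next_prime_subproof n).

(* indexed from 0: [odd_prime 0 = 3], [odd_prime 1 = 5], [odd_prime 2 = 7] *)
Definition odd_prime (i : nat) : nat := iter i next_prime 3.

Lemma odd_prime_prime i : prime (odd_prime i).
Proof.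
by case: i => [//|i] /=; rewrite /next_prime; case: ex_minnP => q /andP[].
Qed.

Lemma odd_prime_lt i j : (i < j)%N -> (odd_prime i < odd_prime j)%N.
Proof.
have lt_next n : (n < next_prime n)%N.
  by rewrite /next_prime; case: ex_minnP => q /andP[].
elim: j => // j IHj; rewrite ltnS leq_eqVlt => /predU1P[->|/IHj ij] /=.
  exact: lt_next.
exact: ltn_trans ij (lt_next _).
Qed.

Lemma odd_primeP q : (prime q && odd q) <-> exists i, odd_prime i = q.
Proof.
split=> [/andP[pq oq]|[i <-]]; last first.
  rewrite odd_prime_prime /=.
  have [//|ev] := boolP (odd (odd_prime i)).
  have [] := even_prime (odd_prime_prime i); last by move=> o; rewrite o in ev.
  case: i {ev} => [//|i] e.
  by have := @odd_prime_lt 0 i.+1 isT; rewrite e.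
have q3 : (3 <= q)%N by case: q pq oq => [|[|[|]]].
have grow i : (i < odd_prime i)%N.
  elim: i => // i IHi; exact: leq_ltn_trans IHi (odd_prime_lt (ltnSn i)).
have ex : exists i, (q <= odd_prime i)%N by exists q; apply: ltnW.
case: (ex_minnP ex) => -[|i] qi imin.
  by exists 0%N; apply/eqP; rewrite eqn_leq qi andbT.
exists i.+1; apply/eqP; rewrite eqn_leq qi andbT.
have iq : (odd_prime i < q)%N.
  by rewrite ltnNge; apply/negP => /imin; rewrite ltnn.
rewrite /= {1}/next_prime; case: ex_minnP => m _; apply.
by rewrite iq pq.
Qed.

Definition H_ (r : nat) := {dffun forall i : 'I_r, SL 4 'F_(odd_prime i)}.

Definition pmI4 (p : nat) : {set SL 4 'F_p} :=
  finset (fun A : SL 4 'F_p => (SLval A == 1%:M) || (SLval A == - 1%:M)).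

Definition Z_ (r : nat) : {set H_ r} :=
  setXn (fun i : 'I_r => pmI4 (odd_prime i)).

Definition pi_ (r : nat) (A : SL 4 int) : H_ r :=
  [ffun i : 'I_r => SL_map (intr : {rmorphism int -> 'F_(odd_prime i)}) A].

Definition L_ (r : nat) : set (SL 4 int) := pi_ r @^-1` [set` Z_ r].

Definition n_ (r : nat) : nat := group_index (L_ r).

Fact pi_monoid_morphism r : monoid.monoid_morphism (@pi_ r).
Proof.
split=> [|A B]; apply/ffunP => i; rewrite !ffunE; first exact: SL_map1.
exact: SL_mapM.
Qed.

HB.instance Definition _ r :=
  isUMagmaMorphism.Build (SL 4 int) (H_ r) (@pi_ r) (pi_monoid_morphism r).

Lemma pi_1 r : pi_ r 1%g = 1%g.
Proof. exact: gmulf1. Qed.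

Lemma pi_M r : {morph pi_ r : A B / (A * B)%g}.
Proof. exact: gmulfM. Qed.

Lemma pi_V r (A : SL 4 int) : pi_ r (A^-1)%g = ((pi_ r A)^-1)%g.
Proof. by apply: (@mulIg _ (pi_ r A)); rewrite -pi_M !mulVg pi_1. Qed.

Lemma pmI4P p (A : SL 4 'F_p) :
  reflect (SLval A = 1%:M \/ SLval A = - 1%:M) (A \in pmI4 p).
Proof. by rewrite inE; apply: (iffP orP) => -[/eqP|/eqP]; [left|right|left|right]. Qed.

Fact group_set_pmI4 p : group_set (pmI4 p).
Proof.
apply/group_setP; split=> [|A B /pmI4P EA /pmI4P EB]; first by apply/pmI4P; left.
apply/pmI4P; rewrite /=.
case: EA => ->; case: EB => ->; rewrite ?mulNmx ?mulmxN ?mul1mx ?opprK;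
  by [left | right].
Qed.

Canonical pmI4_group p := Group (group_set_pmI4 p).

Lemma pmI4J p (A B : SL 4 'F_p) : A \in pmI4 p -> (A ^ B)%g \in pmI4 p.
Proof.
move=> /pmI4P EA; apply/pmI4P; rewrite /=.
case: EA => ->; rewrite ?mulNmx ?mulmxN mul1mx mulVmx ?SL_unitmx //;
  by [left | right].
Qed.

Lemma Z_P r (x : H_ r) :
  reflect (forall i, x i \in pmI4 (odd_prime i)) (x \in Z_ r).
Proof. by rewrite inE; apply: forallP. Qed.

Lemma conjg_ffun r (x y : H_ r) i : (x ^ y)%g i = (x i ^ y i)%g.
Proof. by rewrite /conjg !mulg_ffun invg_ffun. Qed.

Lemma Z_J r (x y : H_ r) : x \in Z_ r -> (x ^ y)%g \in Z_ r.
Proof. by move=> /Z_P Zx; apply/Z_P => i; rewrite conjg_ffun pmI4J. Qed.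

Lemma Z_normal r : normal (Z_ r) [set: H_ r]%SET.
Proof.
apply/andP; split; first exact: finset.subsetT.
apply/fintype.subsetP => y _; rewrite inE; apply/fintype.subsetP => _ /imsetP[x Zx ->].
exact: Z_J.
Qed.

Lemma L_E r (A : SL 4 int) : L_ r A = (pi_ r A \in Z_ r) :> Prop.
Proof. by []. Qed.

Lemma L_normal r : is_normal_subgroup (L_ r).
Proof.
split.
  apply/is_subgroupP; split.
    by rewrite L_E pi_1; apply: group1.
  by move=> A B; rewrite !L_E pi_M pi_V => LA LB; rewrite groupM // groupV.
by move=> A B; rewrite !L_E /conjg !pi_M pi_V => /Z_J; apply.
Qed.

Lemma L_finite_index r : finite_set (left_cosets (L_ r)).
Proof.
pose F (y : H_ r) : set (SL 4 int) := [set A | (y^-1 * pi_ r A)%g \in Z_ r].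
apply: (@sub_finite_set _ _ (F @` [set: H_ r])).
  move=> _ [A _ <-]; exists (pi_ r A) => //; apply/seteqP; split=> [B|_ [B LB <-]].
    rewrite /F /= => ZB; exists (A^-1 * B)%g; last by rewrite mulKVg.
    by rewrite L_E pi_M pi_V.
  by rewrite /F /= pi_M mulKg.
exact/finite_image/finite_finset.
Qed.

(* Main.v *)
(* A generating set of [L_r] maps onto a generating set of [Z_r = (Z/2)^r], so
   [rank(L_r) >= r].  Surjectivity of [L_r -> Z_r] does not need strong
   approximation: an integer [a] with prescribed residues [1] or [-1] modulo the
   [p_i] satisfies [a ^ 2 = 1] modulo each of them, and an explicit element of
   [SL_4(Z)] reduces to [a I_4] modulo every [p_i].
   On the other side [n_r <= |H_r| <= (p_1 ... p_r) ^ 16], and Chebyshev's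
   estimate [2 ^ n <= C(2n, n) <= (2n) ^ pi(2n)] yields [p_i <= r ^ 3], whence
   [log n_r <= 48 r log r].  Since [r < log n_r] implies [log r < log log n_r],
   no lower bound on [n_r] is required. *)
Require Import Defs.
From HB Require Import structures.
From mathcomp Require Import all_boot all_order all_algebra all_fingroup.
From mathcomp Require Import abelian finmap zify ring lra.
From mathcomp Require Import all_classical all_reals all_analysis.

Import Order.TTheory GRing.Theory Num.Theory.

Local Open Scope classical_set_scope.
Local Open Scope ring_scope.

(** * Chebyshev's estimate and the growth of the odd primes *)

(** The added terms vanish since [n < p ^ k] for [k > n]. A common range lets Legendre's formulas
    for [n!] and [(2n)!] be compared termwise. *)
Lemma logn_fact_widen p n N : prime p -> (n <= N)%N ->
  logn p n`! = (\sum_(1 <= k < N.+1) n %/ p ^ k)%N.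
Proof.
move=> p_pr nN; rewrite logn_fact // (big_cat_nat (n := n.+1) _ _ (p := N.+1)) //=.
rewrite [X in (_ + X)%N]big_nat_cond [X in (_ + X)%N]big1 ?addn0 // => k.
move=> /andP[/andP[nk _] _]; apply: divn_small.
exact: (leq_trans nk (ltnW (ltn_expl _ (prime_gt1 p_pr)))).
Qed.

Lemma sum_leq_const N t : (\sum_(1 <= k < N.+1) (k <= t : nat) = minn N t)%N.
Proof.
elim: N => [|N IHN]; first by rewrite big_geq ?min0n.
by rewrite big_nat_recr //= IHN; case: (leqP N.+1 t) => /=; lia.
Qed.

Lemma bin_double_pfactor p n : prime p -> (0 < n)%N ->
  (p ^ logn p 'C(n.*2, n) <= n.*2)%N.
Proof.
move=> p_pr n0; have p1 := prime_gt1 p_pr; have n20 : (0 < n.*2)%N by lia.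
suff le_t : (logn p 'C(n.*2, n) <= trunc_log p n.*2)%N.
  by apply: leq_trans (trunc_logP p1 n20); rewrite leq_exp2l.
have nn : (n <= n.*2)%N by lia.
have := congr1 (logn p) (bin_fact nn).
rewrite (_ : n.*2 - n = n)%N; last by lia.
rewrite !lognM ?muln_gt0 ?fact_gt0 ?bin_gt0 //.
rewrite (logn_fact_widen _ _ _ p_pr nn) (logn_fact_widen _ _ _ p_pr (leqnn n.*2)) => e.
(* Each power [p ^ k <= 2n] contributes at most one carry, and larger powers contribute none. *)
suff : (\sum_(1 <= k < n.*2.+1) n.*2 %/ p ^ k <=
    \sum_(1 <= k < n.*2.+1) (n %/ p ^ k + n %/ p ^ k + (k <= trunc_log p n.*2)))%N.
  by rewrite !big_split /= sum_leq_const; lia.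
apply: leq_sum => k _; have pk0 : (0 < p ^ k)%N by rewrite expn_gt0 prime_gt0.
have [kt|kt] := leqP k (trunc_log p n.*2).
  rewrite -ltnS ltn_divLR //; have := divn_eq n (p ^ k); have := ltn_pmod n pk0.
  by set c := (p ^ k)%N; set b := (n %% c)%N; set a := (n %/ c)%N; rewrite -mul2n; nia.
rewrite divn_small // (leq_trans (trunc_log_ltn _ p1)) // leq_exp2l //.
Qed.

Lemma expn2_le_bin_double n : (2 ^ n <= 'C(n.*2, n))%N.
Proof.
elim: n => [|n IHn]; first by rewrite bin0.
rewrite expnS doubleS binS; apply: leq_trans (_ : 2 * 'C(n.*2, n) <= _)%N.
  by rewrite leq_mul2l.
(* A second use of Pascal's rule produces the previous central coefficient twice. *)
case: n {IHn} => [//|n]; rewrite !(binS n.+1.*2); lia.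
Qed.

Lemma odd_prime_ltE i j : (odd_prime i < odd_prime j)%N = (i < j)%N.
Proof.
have [ij|] := ltnP i j; first by rewrite odd_prime_lt.
by rewrite leq_eqVlt => /predU1P[->|/odd_prime_lt ?]; rewrite ?ltnn // ltnNge ltnW.
Qed.

(** The prime divisors are [2] or among the first [r] odd primes, so at most [r + 1] prime powers
    occur, each at most [2n]. *)
Lemma bin_double_le_expn n r : (0 < n)%N -> (n.*2 < odd_prime r)%N ->
  ('C(n.*2, n) <= n.*2 ^ r.+1)%N.
Proof.
move=> n0 nr; set c := 'C(_, _).
have c0 : (0 < c)%N by rewrite bin_gt0; lia.
have bound p : p \in primes c -> (p ^ logn p c <= n.*2)%N.
  by rewrite mem_primes => /andP[p_pr _]; apply: bin_double_pfactor.
rewrite [c]prod_prime_decomp // prime_decompE big_map /=.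
apply: leq_trans (_ : n.*2 ^ size (primes c) <= _)%N.
  elim: (primes c) bound => [|p s IHs] bound; first by rewrite big_nil.
  rewrite big_cons expnS leq_mul ?bound ?mem_head // IHs // => q qs.
  by rewrite bound // inE qs orbT.
rewrite leq_exp2l; last by lia.
have /uniq_leq_size : {subset primes c <= 2 :: [seq odd_prime i | i <- iota 0 r]}.
  move=> p pc; have := bound p pc; move: (pc); rewrite mem_primes => /and3P[p_pr _ pdc].
  have l0 : (0 < logn p c)%N by rewrite logn_gt0.
  move=> ple; have {ple} pr : (p < odd_prime r)%N.
    apply: leq_ltn_trans nr; apply: leq_trans ple.
    by rewrite -{1}[p]expn1 leq_exp2l // prime_gt1.
  rewrite inE; case: (even_prime p_pr) => [->//|p_odd].
  have /odd_primeP[i ip] : prime p && odd p by rewrite p_pr.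
  by rewrite -ip map_f ?orbT // mem_iota /= add0n -odd_prime_ltE ip.
by rewrite /= size_map size_iota; apply; rewrite primes_uniq.
Qed.

Lemma cube_lt_expn4 t : (10 <= t)%N -> (128 * t.+1 ^ 3 < 4 ^ t)%N.
Proof.
move=> t10; rewrite -(subnK t10); elim: (t - 10)%N => [|s IHs].
  by rewrite !expnS expn0; lia.
rewrite addSn; apply: leq_trans (_ : 4 * (128 * (s + 10).+1 ^ 3).+1 <= _)%N.
  by move: (s + 10)%N (leq_addl s 10) => u u10; rewrite !expnS expn0; nia.
by rewrite [leqRHS]expnS leq_mul2l.
Qed.

(** Suppose [r ^ 3 < 2n] with [2n + 1] the prime, and [2 ^ t <= 2n < 2 ^ (t + 1)]. Chebyshev gives
    [n <= (t + 1)(r + 1)]; cubing [2 ^ t <= 2(t + 1)(r + 1)] and using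
    [(r + 1) ^ 3 <= 8 r ^ 3 <= 16 * 2 ^ t] yields [4 ^ t <= 128 (t + 1) ^ 3], which is false for
    [t >= 10]. *)
Lemma odd_prime_pred_le r : (32 <= r)%N -> ((odd_prime r).-1 <= r ^ 3)%N.
Proof.
move=> r32; rewrite leqNgt; apply/negP => gt_r.
have /andP[p_pr p_odd] : prime (odd_prime r) && odd (odd_prime r).
  by apply/odd_primeP; exists r.
pose n := (odd_prime r)./2; have p_eq : odd_prime r = n.*2.+1.
  by have := odd_double_half (odd_prime r); rewrite p_odd.
move: gt_r; rewrite p_eq /= => gt_r.
have n0 : (0 < n)%N by lia.
have n20 : (0 < n.*2)%N by lia.
have := leq_trans (expn2_le_bin_double n) (bin_double_le_expn _ r n0 _).
rewrite p_eq leqnn => /(_ isT).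
pose t := trunc_log 2 n.*2; have := trunc_log_bounds (ltnSn 1) n20.
rewrite -/t => /andP[le_t lt_t] le_exp.
have {le_exp} : (n <= t.+1 * r.+1)%N.
  rewrite -(leq_exp2l (m := 2)) // (leq_trans le_exp) // expnM leq_exp2r //.
  exact: ltnW.
have t10 : (10 <= t)%N.
  (* The threshold [32] enters here: [2 ^ 10 <= 32 ^ 3 <= r ^ 3]. *)
  apply: trunc_log_max => //; apply: leq_trans (ltnW gt_r).
  apply: leq_trans (_ : (2 ^ 5) ^ 3 <= _)%N; last by rewrite leq_exp2r.
  by rewrite -expnM leq_exp2l.
move=> le_n; have := cube_lt_expn4 t t10; rewrite ltnNge => /negP; apply.
have pos : (0 < 2 ^ t)%N by rewrite expn_gt0.
have e4 : (4 ^ t = 2 ^ t * 2 ^ t)%N by rewrite -expnMn.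
have {}le_t : (2 ^ t <= 2 * (t.+1 * r.+1))%N by lia.
have cube : (2 ^ t * 2 ^ t * 2 ^ t <= 8 * (t.+1 ^ 3 * r.+1 ^ 3))%N.
  have := leq_mul (leq_mul le_t le_t) le_t; move/leq_trans; apply.
  by rewrite !expnS !expn0; move: (t.+1) (r.+1) => a b; apply/eq_leq; ring.
have r1 : (r.+1 ^ 3 <= 8 * r ^ 3)%N by rewrite !expnS !expn0; nia.
have r2 : (r ^ 3 <= 2 * 2 ^ t)%N.
  by rewrite -expnS ltnW // (ltn_trans gt_r).
rewrite e4 -(leq_pmul2r pos); apply: leq_trans cube _.
move: (t.+1 ^ 3)%N (r.+1 ^ 3)%N (r ^ 3)%N (2 ^ t)%N r1 r2 => a b c d r1 r2.
have : (b <= 16 * d)%N by lia.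
by nia.
Qed.

(** * Chinese remaindering and lifts of scalar matrices *)

Lemma odd_prime_gt2 i : (2 < odd_prime i)%N.
Proof. by case: i => [//|i]; exact/ltnW/(@odd_prime_lt 0 i.+1). Qed.

Lemma natr_Fp_eq0 p n : prime p -> (n%:R == 0 :> 'F_p) = (p %| n)%N.
Proof. by move=> p_pr; rewrite (dvdn_pcharf (pchar_Fp p_pr)). Qed.

Lemma prime_dvd_prod p (I : Type) (s : seq I) (F : I -> nat) : prime p ->
  (p %| \prod_(i <- s) F i)%N = has (fun i => p %| F i)%N s.
Proof.
move=> p_pr; elim: s => [|i s IHs]; first by rewrite big_nil /= Euclid_dvd1.
by rewrite big_cons Euclid_dvdM // IHs.
Qed.

Lemma chinese_odd_primes (e : forall i, 'F_(odd_prime i)) r :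
  exists a : nat, forall i, (i < r)%N -> a%:R = e i.
Proof.
elim: r => [|r [a aP]]; first by exists 0%N.
pose N := (\prod_(i < r) odd_prime i)%N.
have N0 : N%:R != 0 :> 'F_(odd_prime r).
  rewrite natr_Fp_eq0 ?odd_prime_prime // prime_dvd_prod ?odd_prime_prime //.
  apply/hasPn => i _; rewrite dvdn_prime2 ?odd_prime_prime //.
  by rewrite gtn_eqF // odd_prime_lt.
(* The quotient is taken in the field of the new prime and read as a natural number; adding [N * k]
   keeps the earlier residues. *)
pose k : nat := (e r - a%:R) / N%:R.
exists (a + N * k)%N => i; rewrite ltnS leq_eqVlt natrD natrM => /predU1P[->|ir].
  by rewrite natr_Zp mulrC divfK // addrC subrK.
rewrite aP //; suff /eqP -> : N%:R == 0 :> 'F_(odd_prime i) by rewrite mul0r addr0.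
rewrite natr_Fp_eq0 ?odd_prime_prime //.
by rewrite /N (bigD1 (Ordinal ir)) //= dvdn_mulr.
Qed.

(* The Steinberg product [h(a) = w(a) w(-1)] with [a] in the place of [a^-1];
   it has determinant 1 for every [a], and equals [a I_4] as soon as [a ^ 2 = 1]. *)
Definition SL4_lift_mx {R : comUnitRingType} (a : R) : 'M[R]_4 :=
  let U (x : R) := block_mx (1%:M : 'M[R]_2) x%:M 0 (1%:M : 'M[R]_2) in
  let L (x : R) := block_mx (1%:M : 'M[R]_2) 0 x%:M (1%:M : 'M[R]_2) in
  U a *m L (- a) *m U a *m (U (- 1) *m L 1 *m U (- 1)).

Lemma det_SL4_lift_mx {R : comUnitRingType} (a : R) : \det (SL4_lift_mx a) == 1.
Proof.
rewrite /SL4_lift_mx !det_mulmx !(det_ublock (n1 := 2) (n2 := 2)).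
by rewrite !(det_lblock (n1 := 2) (n2 := 2)) !det1 !mulr1.
Qed.

Definition SL4_lift {R : comUnitRingType} (a : R) : SL 4 R :=
  MkSL (det_SL4_lift_mx a).

Lemma SL4_lift_mx_block {R : comUnitRingType} (a : R) :
  SL4_lift_mx a = block_mx (a * (2 - a ^+ 2))%:M (a ^+ 2 - 1)%:M
    (1 - a ^+ 2)%:M (a%:M : 'M[R]_2).
Proof.
rewrite /SL4_lift_mx.
rewrite !(mulmx_block (m1 := 2) (m2 := 2) (n1 := 2) (n2 := 2) (p1 := 2) (p2 := 2)).
rewrite !(mulmx1, mul1mx, mulmx0, mul0mx, addr0, add0r) -!(scalar_mxM, raddfD).
by congr (@block_mx _ 2 2 2 2 _ _ _ _); congr (scalar_mx _); ring.
Qed.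

Lemma SL4_lift_sqr1 {R : comUnitRingType} (a : R) : a ^+ 2 = 1 ->
  SL4_lift_mx a = a%:M.
Proof.
move=> a1; rewrite SL4_lift_mx_block a1 subrr (_ : 2 - 1 = 1) ?mulr1; last by ring.
by rewrite raddf0 -(scalar_mx_block 2 2).
Qed.

(** The lift is polynomial in [a] with integer coefficients, so one integer lift controls all the
    reductions at once. *)
Lemma SL4_lift_map {R S : comUnitRingType} (f : {rmorphism R -> S}) (a : R) :
  SL_map f (SL4_lift a) = SL4_lift (f a).
Proof.
apply: val_inj; rewrite /= /SL4_lift_mx !map_mxM /=.
rewrite !(map_block_mx f (m1 := 2) (m2 := 2) (n1 := 2) (n2 := 2)).
by rewrite !map_scalar_mx !map_mx0 !rmorphN !rmorph1.
Qed.

(** * The group [Z_ r] and the lower bound on the rank *)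

Lemma pmI4_scalar {p} {A : SL 4 'F_p} : A \in pmI4 p ->
  exists2 a : 'F_p, a ^+ 2 = 1 & SLval A = a%:M.
Proof.
by case/pmI4P=> ->; [exists 1 | exists (- 1)]; rewrite ?sqrrN ?expr1n // raddfN.
Qed.

Lemma card_pmI4 p : prime p -> (2 < p)%N -> #|pmI4 p| = 2%N.
Proof.
move=> p_pr p2.
have sqN1 : (- 1) ^+ 2 = 1 :> 'F_p by rewrite sqrrN expr1n.
have -> : pmI4 p = [set 1%g; SL4_lift (- 1)]%SET.
  apply/setP=> A; rewrite !inE -!val_eqE /= (SL4_lift_sqr1 _ sqN1).
  by rewrite raddfN.
rewrite cards2 -val_eqE /= (SL4_lift_sqr1 _ sqN1).
(* Equality of the two matrices would give [1 = -1], that is [p] divides [2]. *)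
case: eqP => // /matrixP/(_ 0 0); rewrite !mxE /= mulr1n => /eqP.
rewrite -addr_eq0 -(natrD _ 1 1) natr_Fp_eq0 // => /dvdn_leq; lia.
Qed.

Lemma card_Z_ r : #|Z_ r| = (2 ^ r)%N.
Proof.
have -> : #|Z_ r| = #|(family (fun i : 'I_r => mem (pmI4 (odd_prime i))) :
    simpl_pred {dffun forall i : 'I_r, SL 4 'F_(odd_prime i)})|.
  by apply: eq_card => x; rewrite in_setXn.
rewrite card_family /image_mem; under eq_map => i.
  rewrite card_pmI4 ?odd_prime_prime ?odd_prime_gt2 //; over.
by rewrite -[in RHS](card_ord r) cardE; elim: (enum _) => //= i s ->; rewrite expnS.
Qed.

Lemma Z_abelem r : (2.-abelem (Z_ r))%g.
Proof.
have ZZ (x : H_ r) i : x \in Z_ r -> exists2 a, a ^+ 2 = 1 & SLval (x i) = a%:M.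
  by move=> /Z_P /(_ i) /pmI4_scalar.
apply/(abelemP (G := setXn_group (fun i : 'I_r => pmI4_group (odd_prime i)))) => //.
split=> [|x /= Zx]; last first.
  apply/ffunP => i; rewrite expgS expg1 mulg_ffun; apply: val_inj => /=.
  rewrite ffunE /=.
  by have [a a1 ->] := ZZ x i Zx; rewrite -scalar_mxM -expr2 a1.
apply/centsP => x Zx y Zy; apply/ffunP => i; rewrite !mulg_ffun.
apply: val_inj => /=; have [a _ ->] := ZZ x i Zx; have [b _ ->] := ZZ y i Zy.
by rewrite -!scalar_mxM mulrC.
Qed.

Lemma pi_L r (z : H_ r) : z \in Z_ r -> exists2 A, L_ r A & pi_ r A = z.
Proof.
(* The signs are extended by [+1] from index [r] on, because [chinese_odd_primes] takes residues
   indexed by all of [nat]. *)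
move=> Zz; pose sgn i := if insub i is Some j then SLval (z j) == 1%:M else true.
pose e i : 'F_(odd_prime i) := (-1) ^+ ~~ sgn i.
have [a aP] := chinese_odd_primes e r.
suff pia : pi_ r (SL4_lift a%:R) = z.
  by exists (SL4_lift a%:R); rewrite // L_E pia.
apply/ffunP => i; rewrite ffunE SL4_lift_map rmorph_nat aP //.
apply: val_inj; rewrite /= SL4_lift_sqr1 ?sqrr_sign //.
rewrite /e /sgn valK; have /Z_P/(_ i)/pmI4P := Zz.
by case: eqP => [-> _|_ []// ->]; rewrite ?expr0 ?expr1 ?raddfN.
Qed.

Lemma rank_L_ (R : realType) r : (r%:R%:E <= group_rank R (L_ r))%E.
Proof.
apply: le_ereal_inf_tmp => _ [S /= gS <-].
rewrite /counting; case: ifPn => [/asboolP fS|_]; last exact: leey.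
rewrite lee_fin ler_nat.
pose B : {set H_ r} := finset (mem (map (pi_ r) (fset_set S))).
have BZ : B \subset Z_ r.
  apply/fintype.subsetP => x; rewrite inE => /mapP[A AS ->].
  rewrite -L_E -gS; apply: sub_gen_smallest.
  by move: AS; rewrite in_fset_set // => /set_mem.
have genB : Z_ r = <<B>>%g.
  apply/eqP; rewrite finset.eqEsubset gen_subG BZ andbT.
  apply/fintype.subsetP => x /pi_L[A + <-]; rewrite -gS => gA.
  (* The preimage of [<<B>>] is a subgroup containing [S], hence contains everything [S]
     generates. *)
  have := gA (pi_ r @^-1` [set` <<B>>%g]); apply; split.
    apply/is_subgroupP; split => [|a b /= Ba Bb].
      by rewrite /= pi_1 group1.
    by rewrite pi_M pi_V groupM ?groupV.
  move=> a Sa /=; apply: mem_gen; rewrite inE; apply: map_f.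
  by rewrite in_fset_set // inE.
apply: leq_trans (_ : #|B| <= _)%N.
  (* For an elementary abelian 2-group the minimal number of generators is the 2-logarithm of the
     order. *)
  pose Zg : {group H_ r} := setXn_group (fun i : 'I_r => pmI4_group (odd_prime i)).
  have abZ : (2.-abelem Zg)%g := Z_abelem r.
  have := grank_min B; rewrite -genB.
  rewrite (grank_abelian (G := Zg) (abelem_abelian abZ)) (rank_abelem abZ).
  by rewrite [#|_|]card_Z_ pfactorK.
by rewrite /B cardsE (leq_trans (card_size _)) // size_map.
Qed.

(** * The upper bound on the index and the logarithmic comparison *)

(** Every coset is one of the sets [F y], and these are indexed by [H_ r]. *)
Lemma n_le_card_H r : (n_ r <= #|H_ r|)%N.
Proof.
rewrite /n_ /group_index.
pose F (y : H_ r) : set (SL 4 int) := [set A | (y^-1 * pi_ r A)%g \in Z_ r].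
have sF : left_cosets (L_ r) `<=` F @` [set: H_ r].
  move=> _ [A _ <-]; exists (pi_ r A) => //; apply/seteqP; split=> [B|_ [B LB <-]].
    rewrite /F /= => ZB; exists (A^-1 * B)%g; last by rewrite mulKVg.
    by rewrite L_E pi_M pi_V.
  by rewrite /F /= pi_M mulKg.
have fT : finite_set [set: H_ r] by exact: finite_finset.
apply: leq_trans (fsubset_leq_card (B := fset_set (F @` [set: H_ r])) _) _.
  by rewrite -fset_set_sub //; [exact: L_finite_index | exact: finite_image].
rewrite fset_set_image //; apply: leq_trans (leq_imfset_card _ _ _) _ => /=.
rewrite cardE; apply: uniq_leq_size => [|x _]; last by rewrite mem_enum.
exact: fset_uniq.
Qed.

Lemma card_SL_le p : prime p -> (#|{: SL 4 'F_p}| <= p ^ 16)%N.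
Proof.
move=> p_pr; rewrite -[in leqRHS](card_Fp p_pr) -(card_mx _ 4 4).
by apply: leq_card; exact: val_inj.
Qed.

Lemma n_le r : (32 <= r)%N -> (n_ r <= r ^ (48 * r))%N.
Proof.
move=> r32; apply: leq_trans (n_le_card_H r) _; rewrite card_dep_ffun.
have le_p (i : 'I_r) : (#|{: SL 4 'F_(odd_prime i)}| <= r ^ 48)%N.
  apply: leq_trans (card_SL_le _ (odd_prime_prime _)) _.
  rewrite (expnM r 3 16) leq_exp2r //; apply: leq_trans (odd_prime_pred_le r r32).
  (* As [i < r], the prime is at most [(odd_prime r).-1]. *)
  by have := odd_prime_lt (ltn_ord i); lia.
rewrite expnM /image_mem -[X in (_ <= _ ^ X)%N](card_ord r) cardE; elim: (enum _) => //= i s IHs.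
by rewrite expnS leq_mul.
Qed.

(** With [ln x >= 1 - 1 / x], this is exactly what makes [ln (ln n) >= 1 / 48] for [n >= 3]. It
    follows from [exp (-6 / 47) >= 41 / 47] and [(47 / 41) ^ 8 <= 3]. *)
Lemma ln3_ge {R : realType} : 48 / 47 <= ln 3 :> R.
Proof.
rewrite -[leLHS]expRK ler_ln ?posrE ?expR_gt0 //.
have e1 : 41 / 47 <= expR (- (6 / 47)) :> R.
  by apply: le_trans (expR_ge1Dx _); lra.
have e0 : 0 < (41 / 47 : R) by lra.
have -> : 48 / 47 = - (8%:R * - (6 / 47)) :> R by lra.
rewrite expRN expRM_natl -[leRHS]invrK lef_pV2 ?posrE ?invr_gt0 ?exprn_gt0 ?expR_gt0 //.
apply: le_trans (_ : (41 / 47) ^+ 8 <= _); last by rewrite lerXn2r ?nnegrE ?expR_ge0 ?(ltW e0).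
by rewrite !exprS expr0; lra.
Qed.

Lemma ln_div_lnln_le {R : realType} n r : (1 < r)%N -> (n <= r ^ (48 * r))%N ->
  ln n%:R / (48 * ln (ln n%:R)) <= r%:R :> R.
Proof.
move=> r1 nr; set x : R := ln n%:R; set y := ln x.
have r_gt1 : 1 < r%:R :> R by rewrite ltr1n.
(* For [n <= 2] the quotient is nonpositive, since [ln n <= 1]; the cases [n = 0] and [n = 1] rely
   on [ln 0 = 0]. *)
have [n2|n3] := leqP n 2.
  have x0 : 0 <= x.
    case: (posnP n) => [n0|n0]; first by rewrite /x n0 ln0.
    by rewrite ln_ge0 // ler1n.
  have x1 : x <= 1.
    have [n0|n0] := posnP n; first by rewrite /x n0 ln0.
    rewrite /x; have -> : n%:R = 1 + n.-1%:R :> R by rewrite -{1}(prednK n0) -natr1 addrC.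
    apply: le_trans (le_ln1Dx _) _; last by rewrite lern1; lia.
    by rewrite (lt_le_trans (y := 0)) ?ler0n // ltrN10.
  apply: le_trans (ltW (lt_trans ltr01 r_gt1)).
  by rewrite mulr_ge0_le0 // invr_le0 mulr_ge0_le0 // ln_le0.
have n_gt0 : 0 < n%:R :> R by rewrite ltr0n; lia.
have x_ge : 48 / 47 <= x.
  by apply: le_trans ln3_ge _; rewrite ler_ln ?posrE // ?ler_nat //; lra.
have x_gt0 : 0 < x by lra.
have y_ge : 1 / 48 <= y.
  have : ln x^-1 <= x^-1 - 1.
    have := @le_ln1Dx R (x^-1 - 1); rewrite (addrC 1) subrK; apply.
    by have : 0 < x^-1 by [rewrite invr_gt0]; lra.
  rewrite lnV ?posrE // -/y; have : x^-1 <= 47 / 48.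
    by rewrite -[leRHS]invrK lef_pV2 ?posrE ?invr_gt0 //; lra.
  by lra.
rewrite ler_pdivrMr; last by lra.
(* If [x <= r], the denominator [48 y >= 1] suffices; otherwise [y >= ln r] absorbs
   [x <= 48 r ln r]. *)
have [xr|rx] := leP x r%:R.
  by apply: le_trans xr _; rewrite ler_peMr //; lra.
have y_ge_ln : ln r%:R <= y.
  by rewrite /y ler_ln ?posrE // ?ltW //; lra.
apply: le_trans (_ : 48 * r%:R * ln r%:R <= _); last first.
  by rewrite (mulrC 48) -mulrA ler_wpM2l // ?ler0n // ler_wpM2l.
have : x <= ln (r ^ (48 * r))%:R.
  by rewrite /x ler_ln ?posrE // ?ler_nat // ltr0n expn_gt0; lia.
by rewrite natrX lnXn ?(lt_trans ltr01) // -natrM mulr_natl.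
Qed.

Theorem mainTheorem4 (R : realType) :
  \forall r \near \oo,
    ((ln (n_ r)%:R / (48 * ln (ln (n_ r)%:R)) : R)%:E
       <= group_rank R (L_ r))%E.
Proof.
exists 32%N => // r /= r32; apply: le_trans (rank_L_ R r).
by rewrite lee_fin ln_div_lnln_le ?n_le //; apply: leq_trans r32.
Qed.
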